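(* Let $\mathbf{M}\in\mathbb{Z}^{n\times n}$ (not necessarily symmetric), let $\Delta_{\mathbf{M}}$ be the discriminant of its characteristic polynomial, and let $p$ be a prime. Then $p \nmid \Delta_{\mathbf{M}}$ if and only if it holds for all monic $\beta(x) \in \mathbb{Z}[x]$ with irreducible reduction in $\mathbb{F}_p[x]$ that, as $\mathbb{Z}[x]$-modules, $$\frac{\operatorname{coker}(\mathbf{M} - x\mathbf{I})_{p,\beta}}{p \operatorname{coker}(\mathbf{M} - x\mathbf{I})_{p,\beta}} \cong 0 \qquad\text{or}\qquad \frac{\operatorname{coker}(\mathbf{M} - x\mathbf{I})_{p,\beta}}{p \operatorname{coker}(\mathbf{M} - x\mathbf{I})_{p,\beta}} \cong \frac{\mathbb{F}_p[x]}{\beta(x)\mathbb{F}_p[x] }.$$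
   Context: $\Delta_{\mathbf{M}}$ is the discriminant of $\varphi_{\mathbf{M}}(\lambda)=\det(\lambda\mathbf{I}-\mathbf{M})$, where the discriminant of a monic $\phi\in\mathbb{Z}[x]$ of degree at least one is the resultant $\operatorname{Res}(\phi,\phi')$ of $\phi$ and its formal derivative (the sign convention is immaterial). $\operatorname{coker}(\mathbf{M}-x\mathbf{I})=\mathbb{Z}[x]^n/(\mathbf{M}-x\mathbf{I})\mathbb{Z}[x]^n$ as a $\mathbb{Z}[x]$-module, with $\mathbf{I}$ the identity. For a prime $p$ and a monic $\beta\in\mathbb{Z}[x]$ with irreducible reduction in $\mathbb{F}_p[x]$, $R_{p,\beta}$ denotes the completion of $\mathbb{Z}[x]$ at the maximal ideal $(p,\beta)$; equivalently the ring of formal series $\sum_{i\ge0}c_i\beta^i$ with $c_i\in\mathbb{Z}_p[x]$, $\deg c_i<\deg\beta$, i.e. $\mathbb{Z}_p[x][[y]]/(y-\beta(x))$. For a $\mathbb{Z}[x]$-module $\mathscr{M}$, $\mathscr{M}_{p,\beta}=\mathscr{M}\otimes_{\mathbb{Z}[x]}R_{p,\beta}$. *)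

(* Defs.v *)
From HB Require Import structures.
From mathcomp Require Import all_boot all_algebra generic_quotient ring_quotient.
From mathcomp Require Import boolp functions.
From mathcomp Require Import freeg.

Set Implicit Arguments.
Unset Strict Implicit.
Unset Printing Implicit Defensive.

Import GRing.Theory.
Local Open Scope ring_scope.
Local Open Scope quotient_scope.

Section QuotientModule.
Variables (R : pzRingType) (V : lmodType R) (N : submodClosed V).

Definition submod_pred : {pred V} := N.

Lemma submod_pred_zmod_closed : zmod_closed submod_pred.
Proof. exact: (submodClosedP N). Qed.

HB.instance Definition _ :=
  GRing.isZmodClosed.Build V submod_pred submod_pred_zmod_closed.

Definition quotmod : Type := Quotient.quot submod_pred.
HB.instance Definition _ := GRing.Zmodule.on quotmod.

Definition quotpi (v : V) : quotmod := \pi_(Quotient.quot submod_pred) v.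

Lemma quotpi_ind (P : quotmod -> Prop) :
  (forall v, P (quotpi v)) -> forall x, P x.
Proof. by move=> Ppi x; rewrite -[x]reprK; exact: Ppi. Qed.

Lemma quotpi_eq (u v : V) : quotpi u = quotpi v <-> u - v \in N.
Proof.
by split=> [/eqmodP|uvN]; [|apply/eqmodP]; rewrite /= Quotient.equivE.
Qed.

Lemma quotpi_is_zmod_morphism : zmod_morphism quotpi.
Proof. by move=> u v; rewrite /quotpi raddfB. Qed.

HB.instance Definition _ := GRing.isZmodMorphism.Build V quotmod
  quotpi quotpi_is_zmod_morphism.

Definition quotmod_scale (a : R) (x : quotmod) : quotmod :=
  quotpi (a *: repr x).

Lemma quotmod_scaleE a v : quotmod_scale a (quotpi v) = quotpi (a *: v).
Proof.
apply/quotpi_eq; rewrite -scalerBr; apply: rpredZ; apply/quotpi_eq.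
exact: reprK.
Qed.

Let scaleA a b x :
  quotmod_scale a (quotmod_scale b x) = quotmod_scale (a * b) x.
Proof. by elim/quotpi_ind: x => v; rewrite !quotmod_scaleE scalerA. Qed.

Let scale1 : left_id 1 quotmod_scale.
Proof. by elim/quotpi_ind => v; rewrite quotmod_scaleE scale1r. Qed.

Let scaleDr : right_distributive quotmod_scale +%R.
Proof.
move=> a; elim/quotpi_ind => u; elim/quotpi_ind => v.
by rewrite -raddfD !quotmod_scaleE -raddfD scalerDr.
Qed.

Let scaleDl x : {morph quotmod_scale^~ x : a b / a + b}.
Proof.
elim/quotpi_ind: x => v a b /=.
by rewrite !quotmod_scaleE -raddfD scalerDl.
Qed.

HB.instance Definition _ := GRing.Zmodule_isLmodule.Build R quotmod
  scaleA scale1 scaleDr scaleDl.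

Lemma quotpi_is_scalable : scalable quotpi.
Proof. by move=> a v; rewrite -quotmod_scaleE. Qed.

HB.instance Definition _ := GRing.isScalable.Build R V quotmod *:%R
  quotpi quotpi_is_scalable.

End QuotientModule.

Section SpanCokernel.
Variables (R : pzRingType) (U V : lmodType R).

Definition span_of (S : V -> Prop) : {pred V} := fun v =>
  `[< exists2 s : seq (R * V),
        forall c, c \in s -> S c.2 & v = \sum_(c <- s) c.1 *: c.2 >].

Lemma span_of_submod_closed S : submod_closed (span_of S).
Proof.
split=> [|a u v /asboolP[s Ss ->] /asboolP[t St ->]]; apply/asboolP.
  by exists [::]; rewrite ?big_nil.
exists ([seq (a * c.1, c.2) | c <- s] ++ t).
  by move=> c; rewrite mem_cat => /orP[/mapP[d /Ss Sd ->]|/St].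
rewrite big_cat big_map scaler_sumr; congr (_ + _).
by apply: eq_bigr => c _; rewrite scalerA.
Qed.

HB.instance Definition _ S :=
  GRing.isSubmodClosed.Build R V (span_of S) (span_of_submod_closed S).

Definition image_of (f : {linear U -> V}) : {pred V} :=
  fun v => `[< exists u, v = f u >].

Lemma image_of_submod_closed f : submod_closed (image_of f).
Proof.
split=> [|a u v /asboolP[x ->] /asboolP[y ->]]; apply/asboolP.
  by exists 0; rewrite linear0.
by exists (a *: x + y); rewrite linearP.
Qed.

HB.instance Definition _ f :=
  GRing.isSubmodClosed.Build R V (image_of f) (image_of_submod_closed f).

Definition lcoker (f : {linear U -> V}) := quotmod (image_of f).
HB.instance Definition _ f := GRing.Lmodule.on (lcoker f).

Definition liso : Prop := exists f : {linear U -> V}, bijective f.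

End SpanCokernel.
Arguments liso {R} U V.

(* V / aV *)
Definition modscale (R : comNzRingType) (a : R) (V : lmodType R) :=
  lcoker (GRing.scale a : {linear V -> V}).
HB.instance Definition _ (R : comNzRingType) (a : R) (V : lmodType R) :=
  GRing.Lmodule.on (modscale a V).

Section RestrictScalars.
Variables (R S : pzRingType) (f : {rmorphism R -> S}) (V : lmodType S).

Definition restrict_scalars (_ : {rmorphism R -> S}) : Type := V.
HB.instance Definition _ := GRing.Zmodule.on (restrict_scalars f).

Definition restrict_scale (a : R) (v : restrict_scalars f) : restrict_scalars f :=
  f a *: (v : V).

Let scaleA a b v : restrict_scale a (restrict_scale b v) = restrict_scale (a * b) v.
Proof. by rewrite /restrict_scale rmorphM scalerA. Qed.

Let scale1 : left_id 1 restrict_scale.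
Proof. by move=> v; rewrite /restrict_scale rmorph1 scale1r. Qed.

Let scaleDr : right_distributive restrict_scale +%R.
Proof. by move=> a u v; rewrite /restrict_scale scalerDr. Qed.

Let scaleDl v : {morph restrict_scale^~ v : a b / a + b}.
Proof. by move=> a b; rewrite /restrict_scale rmorphD scalerDl. Qed.

HB.instance Definition _ := GRing.Zmodule_isLmodule.Build R (restrict_scalars f)
  scaleA scale1 scaleDr scaleDl.

End RestrictScalars.
Arguments restrict_scalars {R S} V f.

Section Tensor.
Variables (R : comNzRingType) (A B : lmodType R).

Local Notation gen a b := (<< (a : A, b : B) >> : {freeg (A * B)%type / R}).

Inductive tensor_relator : {freeg (A * B)%type / R} -> Prop :=
| TensorAddl a a' b : tensor_relator (gen (a + a') b - gen a b - gen a' b)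
| TensorAddr a b b' : tensor_relator (gen a (b + b') - gen a b - gen a b')
| TensorScalel r a b : tensor_relator (gen (r *: a) b - r *: gen a b)
| TensorScaler r a b : tensor_relator (gen a (r *: b) - r *: gen a b).

Definition tensor := quotmod (span_of tensor_relator).
HB.instance Definition _ := GRing.Lmodule.on tensor.

End Tensor.
Arguments tensor {R} A B.

Section AdicCompletion.
Variable A : comNzRingType.

Definition ideal_gen (S : A -> Prop) : {pred A} := @span_of A A^o S.

Fixpoint ideal_pow (I : {pred A}) (k : nat) : {pred A} :=
  if k is k'.+1 then
    ideal_gen (fun c => exists a b, [/\ a \in I, b \in ideal_pow I k' & c = a * b])
  else predT.

Lemma ideal_pow_submod_closed I k : @submod_closed A A^o (ideal_pow I k).
Proof. by case: k => [|k] //=; exact: span_of_submod_closed. Qed.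

Lemma ideal_pow0 I k : 0 \in ideal_pow I k.
Proof. by case: (ideal_pow_submod_closed I k). Qed.

Lemma ideal_powD I k a b :
  a \in ideal_pow I k -> b \in ideal_pow I k -> a + b \in ideal_pow I k.
Proof.
case: (ideal_pow_submod_closed I k) => _ + Ia Ib => /(_ 1 _ _ Ia Ib).
by rewrite scale1r.
Qed.

Lemma ideal_powM I k a b : b \in ideal_pow I k -> a * b \in ideal_pow I k.
Proof.
case: (ideal_pow_submod_closed I k) => I0 + Ib => /(_ a _ _ Ib I0).
by rewrite addr0.
Qed.

Lemma ideal_powN I k a : a \in ideal_pow I k -> - a \in ideal_pow I k.
Proof. by move=> /(ideal_powM (-1)); rewrite mulN1r. Qed.

(* The completion at I is the inverse limit of the rings A / I^k; a compatible *)
(* family of residue classes is given by a sequence of representatives, up to  *)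
(* sequences whose k-th term is in I^k for all k.                              *)
Variable I : {pred A}.

Definition coherent : {pred nat -> A} :=
  fun f => `[< forall k, f k.+1 - f k \in ideal_pow I k >].

Lemma coherent_subring_closed : subring_closed coherent.
Proof.
split=> [|f g /asboolP cf /asboolP cg|f g /asboolP cf /asboolP cg];
  apply/asboolP => k.
- by rewrite subrr ideal_pow0.
- have -> : (f - g) k.+1 - (f - g) k = (f k.+1 - f k) - (g k.+1 - g k).
    by rewrite [(f - g) _]/(_ - _) [(f - g) k]/(_ - _) !opprD !opprK addrACA.
  by rewrite ideal_powD ?ideal_powN.
have -> : (f * g) k.+1 - (f * g) k =
    g k.+1 * (f k.+1 - f k) + f k * (g k.+1 - g k).
  by rewrite !mulrBr addrA ![g k.+1 * _]mulrC subrK.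
by rewrite ideal_powD ?ideal_powM.
Qed.

HB.instance Definition _ :=
  GRing.isSubringClosed.Build (nat -> A) coherent coherent_subring_closed.

Record cohseq := CohSeq { cohseq_val :> nat -> A; _ : cohseq_val \in coherent }.
HB.instance Definition _ := [isSub for cohseq_val].
HB.instance Definition _ := [Choice of cohseq by <:].
HB.instance Definition _ :=
  GRing.SubChoice_isSubComPzRing.Build (nat -> A) coherent cohseq
    coherent_subring_closed.

Definition cohnull : {pred cohseq} :=
  fun f => `[< forall k, f k \in ideal_pow I k >].

Lemma cohnull_zmod_closed : zmod_closed cohnull.
Proof.
split=> [|f g /asboolP nf /asboolP ng]; apply/asboolP => k.
  exact: ideal_pow0.
by apply: ideal_powD; [exact: nf|apply: ideal_powN; exact: ng].
Qed.

HB.instance Definition _ :=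
  GRing.isZmodClosed.Build cohseq cohnull cohnull_zmod_closed.

Definition completion : Type := Quotient.quot cohnull.
HB.instance Definition _ := GRing.Zmodule.on completion.

Definition clspi (f : cohseq) : completion := \pi_(Quotient.quot cohnull) f.

Lemma clspi_ind (P : completion -> Prop) :
  (forall f, P (clspi f)) -> forall x, P x.
Proof. by move=> Ppi x; rewrite -[x]reprK; exact: Ppi. Qed.

Lemma clspi_eq (f g : cohseq) :
  clspi f = clspi g <-> forall k, f k - g k \in ideal_pow I k.
Proof.
split=> [/eqmodP|fgN]; first by rewrite /= Quotient.equivE => /asboolP.
by apply/eqmodP; rewrite /= Quotient.equivE; apply/asboolP.
Qed.

Lemma clspi_is_zmod_morphism : zmod_morphism clspi.
Proof. by move=> f g; rewrite /clspi raddfB. Qed.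

HB.instance Definition _ := GRing.isZmodMorphism.Build cohseq completion
  clspi clspi_is_zmod_morphism.

Definition completion_mul (x y : completion) : completion :=
  clspi (repr x * repr y).

Lemma completion_mulE (f g : cohseq) :
  completion_mul (clspi f) (clspi g) = clspi (f * g).
Proof.
have reprB (h : cohseq) k : repr (clspi h) k - h k \in ideal_pow I k.
  by move: k; apply/clspi_eq; exact: reprK.
apply/clspi_eq => k; set f' := repr _; set g' := repr _.
have -> : (f' * g') k - (f * g) k = g' k * (f' k - f k) + f k * (g' k - g k).
  by rewrite !mulrBr addrA ![g' k * _]mulrC subrK.
by apply: ideal_powD; apply: ideal_powM; exact: reprB.
Qed.

Let mulA : associative completion_mul.
Proof.
elim/clspi_ind => f; elim/clspi_ind => g; elim/clspi_ind => h.
by rewrite !completion_mulE mulrA.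
Qed.

Let mulC : commutative completion_mul.
Proof.
by elim/clspi_ind => f; elim/clspi_ind => g; rewrite !completion_mulE mulrC.
Qed.

Let mul1 : left_id (clspi 1) completion_mul.
Proof. by elim/clspi_ind => f; rewrite completion_mulE mul1r. Qed.

Let mulDl : left_distributive completion_mul +%R.
Proof.
elim/clspi_ind => f; elim/clspi_ind => g; elim/clspi_ind => h.
by rewrite -raddfD !completion_mulE -raddfD mulrDl.
Qed.

HB.instance Definition _ := GRing.Zmodule_isComPzRing.Build completion
  mulA mulC mul1 mulDl.

Lemma clspi_is_monoid_morphism : monoid_morphism clspi.
Proof. by split=> // f g; rewrite -completion_mulE. Qed.

HB.instance Definition _ := GRing.isMonoidMorphism.Build cohseq completion
  clspi clspi_is_monoid_morphism.

Lemma const_coherent (a : A) : (fun=> a) \in coherent.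
Proof. by apply/asboolP => k; rewrite subrr ideal_pow0. Qed.

Definition to_completion (a : A) : completion := clspi (CohSeq (const_coherent a)).

Lemma to_completion_is_zmod_morphism : zmod_morphism to_completion.
Proof. by move=> a b; rewrite -raddfB; congr clspi; exact: val_inj. Qed.

Lemma to_completion_is_monoid_morphism : monoid_morphism to_completion.
Proof.
split=> [|a b]; first by rewrite -(rmorph1 clspi); congr clspi; exact: val_inj.
by rewrite -rmorphM; congr clspi; exact: val_inj.
Qed.

HB.instance Definition _ := GRing.isZmodMorphism.Build A completion
  to_completion to_completion_is_zmod_morphism.
HB.instance Definition _ := GRing.isMonoidMorphism.Build A completion
  to_completion to_completion_is_monoid_morphism.

End AdicCompletion.

Definition reduce_mod (p : nat) : {poly int} -> {poly 'F_p} :=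
  map_poly (intr : int -> 'F_p).
HB.instance Definition _ p := GRing.RMorphism.on (reduce_mod p).

Definition max_ideal (p : nat) (beta : {poly int}) : {pred {poly int}} :=
  ideal_gen (fun c => c = p%:R \/ c = beta).

Definition Rpb (p : nat) (beta : {poly int}) := completion (max_ideal p beta).
HB.instance Definition _ p beta := GRing.ComPzRing.on (Rpb p beta).

Definition to_Rpb (p : nat) (beta : {poly int}) : {poly int} -> Rpb p beta :=
  to_completion (max_ideal p beta).
HB.instance Definition _ p beta := GRing.RMorphism.on (to_Rpb p beta).

(* N tensored over Z[x] with the completion; only its Z[x]-module structure is *)
(* recorded.                                                                   *)
Definition loc_pb (p : nat) (beta : {poly int}) (N : lmodType {poly int}) :=
  tensor N (restrict_scalars (Rpb p beta)^o (to_Rpb p beta)).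
HB.instance Definition _ p beta N := GRing.Lmodule.on (@loc_pb p beta N).

Definition coker_MxI (n : nat) (M : 'M[int]_n) :=
  lcoker (mulmx (map_mx polyC M - 'X%:M) : {linear 'cV[{poly int}]_n -> 'cV_n}).
HB.instance Definition _ n (M : 'M[int]_n) := GRing.Lmodule.on (coker_MxI M).

(* beta acts on F_p[x] through its reduction, so this is F_p[x] / beta F_p[x]. *)
Definition Fpx_mod (p : nat) (beta : {poly int}) :=
  modscale beta (restrict_scalars {poly 'F_p}^o (reduce_mod p)).
HB.instance Definition _ p beta := GRing.Lmodule.on (Fpx_mod p beta).

Definition disc (phi : {poly int}) : int := resultant phi phi^`().

(* Main.v *)
From HB Require Import structures.
Require Import Defs.
From mathcomp Require Import all_boot all_algebra.
From mathcomp Require Import perm separable generic_quotient boolp freeg ring.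

Set Implicit Arguments.
Unset Strict Implicit.
Unset Printing Implicit Defensive.

Import GRing.Theory Num.Theory.
Local Open Scope ring_scope.
Local Open Scope quotient_scope.

(** Write A = Z[x], phi for the characteristic polynomial of M, N for the
cokernel of M - xI, R for the completion of A at (p, beta), and
Q = (N (x) R) / p (N (x) R). Bars denote reduction modulo p. As phi is monic,
the determinant of its Sylvester matrix with phi' vanishes modulo p exactly when
phi-bar and its derivative have a common factor, so that p does not divide the
discriminant if and only if phi-bar is separable ([dvdz_disc]). The theorem
therefore says that phi-bar is separable if and only if each Q is zero or the
residue field F_p[x]/beta.

Two facts about R are used. An element of A outside (p, beta) becomes a unit of
R, because 1 - t is inverted by a geometric series for t in (p, beta)
([unit_in_Rpb]); and R = A + pR + beta R ([completion_decomp]).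

Suppose that phi-bar is separable. The Cramer rule gives phi N = 0. If beta-bar
does not divide phi-bar, then phi is a unit in R that kills N, so Q = 0.
Otherwise phi = beta g modulo p with g a unit in R, so beta kills Q. Moreover
phi' is not in (p, beta) and is the sum of the principal minors of xI - M, so
some principal minor m, say the i-th, is not in (p, beta). The Cramer rule for
the matrix xI - M with its i-th column replaced by the basis vector e_i shows
that m N lies in A e_i ([coker_minor_cyclic]). As m is a unit in R and
R = A + pR + beta R, the A-module Q is generated by e_i (x) 1; it is killed by
the maximal ideal (p, beta), so it is zero or the residue field.

Suppose that phi-bar is not separable. Over the perfect field F_p it has a
square factor beta-bar^2 with beta-bar irreducible
([nonseparable_square_factor]). Since R maps to A / (p, beta^2), a column v with
v (x) 1 = 0 in Q lies in the column space of (xI - M | p | beta^2)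
([qtens_cokernel_eq0]). If Q were zero or the residue field, then either all
e_j (x) 1 would vanish, or some e_i (x) 1 would be killed by beta and have all
e_j (x) 1 as multiples. The columns of a matrix E of determinant 1, or beta,
would then be columns of (xI - M) Y modulo (p, beta^2), whence
det E = phi det Y = 0 modulo (p, beta^2): beta-bar^2 would divide 1 or beta-bar
([not_liso_of_square]). *)

(** * Separability over F_p and reduction modulo p *)

Lemma exists_irreducible_factor (F : fieldType) (f : {poly F}) :
  (1 < size f)%N ->
  exists b : {poly F}, [/\ b \is monic, irreducible_poly b & b %| f].
Proof.
have [m] := ubnP (size f); elim: m f => // m IHm f le_f_m f_gt1.
have f_neq0 : f != 0 by rewrite -size_poly_gt0 ltnW.
have [[q [q_n1 q_f f'q]]|irr_f] :=
    pselect (exists q : {poly F}, [/\ size q != 1%N, q %| f & ~~ (q %= f)]);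
    last first.
  exists ((lead_coef f)^-1 *: f).
  have nz : (lead_coef f)^-1 != 0 by rewrite invr_eq0 lead_coef_eq0.
  split; last by rewrite dvdpZl.
    by rewrite monicE lead_coefZ mulVf // lead_coef_eq0.
  split=> [|q q_n1]; first by rewrite size_scale.
  rewrite dvdpZr // => q_f; rewrite eqp_sym (eqp_trans (eqp_scale _ _)) //.
  by rewrite eqp_sym; apply: contra_notT irr_f => f'q; exists q.
have q_neq0 : q != 0 by apply: contraTneq q_f => ->; rewrite dvd0p.
have lt_q_f : (size q < size f)%N.
  by rewrite ltn_neqAle dvdp_leq // andbT (dvdp_size_eqp q_f).
have [||b [mb irrb b_q]] := IHm q.
- by rewrite -ltnS (leq_trans _ le_f_m).
- by rewrite ltn_neqAle eq_sym q_n1 size_poly_gt0.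
by exists b; split=> //; apply: dvdp_trans b_q q_f.
Qed.

Section PrimeField.
Variable (p : nat).
Hypothesis p_prime : prime p.

(** Only exponents divisible by p occur in u, and F_p is fixed by Frobenius, so
u is the p-th power of the polynomial with the same coefficients in which every
exponent is divided by p. *)
Lemma deriv_eq0_Fp_power (u : {poly 'F_p}) : u^`() = 0 -> exists g, u = g ^+ p.
Proof.
move=> u'0; have pcharFp := pchar_Fp p_prime.
have pcharFpX : p \in [pchar {poly 'F_p}] by rewrite pchar_poly.
have u_i i : ~~ (p %| i)%N -> u`_i = 0.
  case: i => [|i] p'i; first by rewrite dvdn0 in p'i.
  move/polyP: u'0 => /(_ i)/eqP; rewrite coef_deriv coef0 -mulr_natr mulf_eq0.
  by rewrite -(dvdn_pcharf pcharFp) (negPf p'i) orbF => /eqP.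
have p_gt0 := prime_gt0 p_prime.
exists (\poly_(i < size u) u`_(p * i)).
rewrite -(pFrobenius_autE pcharFpX) poly_def rmorph_sum /=.
apply/polyP=> j; rewrite coef_sum.
under eq_bigr => i _ do
  rewrite pFrobenius_autE exprZn -exprM -(pFrobenius_autE pcharFp) coefZ coefXn.
have Frob_id (x : 'F_p) : pFrobenius_aut pcharFp x = x.
  by rewrite -[x]natr_Zp pFrobenius_aut_nat.
under eq_bigr => i _ do rewrite Frob_id.
have [/dvdnP[k ->]|p'j] := boolP (p %| j)%N; last first.
  rewrite u_i // big1 // => i _; case: eqP => [ij|]; last by rewrite mulr0.
  by rewrite ij dvdn_mull in p'j.
have [lt_k|le_k] := ltnP k (size u).
  rewrite (bigD1 (Ordinal lt_k)) //= eqxx mulr1 mulnC big1 ?addr0 // => i i'k.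
  rewrite [(i * p)%N]mulnC eqn_pmul2l // -val_eqE /= eq_sym in i'k *.
  by rewrite (negPf i'k) mulr0.
rewrite nth_default ?big1 // => [i _|].
  rewrite eqn_pmul2r // gtn_eqF ?mulr0 //; exact: leq_trans le_k.
by rewrite (leq_trans le_k) // leq_pmulr.
Qed.

(** A non-separable polynomial has either a square factor or a nonconstant
factor with zero derivative; over F_p the latter is a p-th power, which also
yields a square. *)
Lemma nonseparable_square_factor (f : {poly 'F_p}) : ~~ separable_poly f ->
  exists b, [/\ b \is monic, irreducible_poly b & b ^+ 2 %| f].
Proof.
move=> nsep; apply: contrapT => sqf; case/negP: nsep.
have coprime_of u v : u * v %| f -> coprimep u v.
  move=> uv_f; rewrite coprimep_def eqn_leq size_poly_gt0 andbC leqNgt.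
  have [g0|/= g_neq0] := eqVneq; last first.
    apply/negP=> /exists_irreducible_factor[b [mb irrb b_g]]; case: sqf.
    exists b; split=> //; apply: dvdp_trans uv_f.
    by rewrite dvdp_mul // (dvdp_trans b_g) ?dvdp_gcdl ?dvdp_gcdr.
  (* A zero gcd forces f = 0, which is divisible by any square. *)
  have /andP[/eqP u0 _] : (u == 0) && (v == 0) by rewrite -gcdp_eq0 g0.
  rewrite u0 mul0r dvd0p in uv_f; case: sqf; exists 'X.
  split; rewrite ?monicX // ?(eqP uv_f) ?dvdp0 //.
  by have := irredp_XsubC (0 : 'F_p); rewrite subr0.
apply/separable_polyP; split=> // u u_f u_gt1.
apply: contraTneq u_gt1 => /deriv_eq0_Fp_power[g u_g].
have : coprimep g g.
  apply/coprime_of/(dvdp_trans _ u_f); rewrite u_g -expr2.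
  by rewrite dvdp_exp2l // prime_gt1.
rewrite coprimepp -leqNgt u_g => /size_poly1P[c c0 ->].
by rewrite -polyC_exp size_polyC_leq1.
Qed.

Lemma intr_Fp_eq0 (m : int) : ((m%:~R : 'F_p) == 0) = (p%:Z %| m)%Z.
Proof. by rewrite -(dvdz_pcharf (pchar_Fp p_prime)). Qed.

Lemma reduce_mod_eq0 (a : {poly int}) :
  reduce_mod p a = 0 -> exists c, a = p%:R * c.
Proof.
move=> /polyP a0; exists (\poly_(i < size a) (a`_i %/ p%:Z)%Z).
apply/polyP=> i; rewrite mulr_natl coefMn coef_poly.
have /eqP := a0 i; rewrite coef_map coef0 intr_Fp_eq0 => /divzK {1}<-.
case: ltnP => [_|/(nth_default 0)->]; first by rewrite -mulr_natr natz.
by rewrite div0z mul0rn mul0r.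
Qed.

(** The coefficients are lifted to their representatives in [0, p). *)
Lemma monic_lift (b : {poly 'F_p}) :
  exists a : {poly int}, reduce_mod p a = b /\ (b \is monic -> a \is monic).
Proof.
pose a := \poly_(i < size b) (val b`_i)%:Z.
have redb : reduce_mod p a = b.
  apply/polyP=> i; rewrite coef_map coef_poly.
  case: ltnP => [_|/(nth_default 0)->//]; exact: natr_Zp.
exists a; split=> // mb.
have sz_b : (0 < size b)%N by rewrite size_poly_gt0 monic_neq0.
have lead_a : a`_(size b).-1 = 1.
  rewrite coef_poly prednK // leqnn -lead_coefE (monicP mb) /=.
  by rewrite Fp_cast // modn_small // prime_gt1.
have sz_a : size a = size b.
  apply/eqP; rewrite eqn_leq size_poly leqNgt; apply/negP => lt_ab.
  have := oner_neq0 int; rewrite -lead_a nth_default ?eqxx //.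
  by rewrite -ltnS prednK.
by rewrite monicE lead_coefE sz_a lead_a.
Qed.

(** Divisibility in F_p[x] is membership of the ideal (b, p) of Z[x]. *)
Lemma dvdp_reduce_mod (b a : {poly int}) :
  reduce_mod p b %| reduce_mod p a <-> exists c d, a = b * c + p%:R * d.
Proof.
have red_p c : reduce_mod p (p%:R * c) = 0.
  rewrite rmorphM rmorph_nat /= -polyC_natr.
  by rewrite (pcharf0 (pchar_Fp p_prime)) mul0r.
split=> [/dvdpP[q a_qb]|[c [d ->]]]; last first.
  by rewrite rmorphD /= -!/(reduce_mod p _) red_p addr0 rmorphM dvdp_mulr.
have [c [redc _]] := monic_lift q.
have [d a_d] : exists d, a - b * c = p%:R * d.
  apply: reduce_mod_eq0; rewrite rmorphB rmorphM /= -!/(reduce_mod p _).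
  by rewrite redc a_qb mulrC subrr.
by exists c, d; rewrite -a_d addrC subrK.
Qed.

End PrimeField.

(** * Discriminants and determinants *)

(** The determinant is that of the Sylvester matrix mapped to F, whose size is
given by f and g over R. It may be larger than the Sylvester matrix of the
images of f and g when the leading coefficient of g is mapped to zero, as
happens for the derivative in characteristic dividing the degree. A vector of
its kernel encodes u and v, not both zero, with u f + v g = 0 over F and v of
degree less than that of f; this is impossible when f and g are coprime over
F. *)
Lemma det_map_Sylvester_eq0 (R : nzRingType) (F : fieldType)
    (h : {rmorphism R -> F}) (f g : {poly R}) :
    f \is monic -> \det (map_mx h (Sylvester_mx f g)) = 0 ->
  ~~ coprimep (map_poly h f) (map_poly h g).
Proof.
move=> mf /eqP/det0P[uv nz_uv].
set f' := map_poly h f; set g' := map_poly h g.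
have sz_f' : size f' = size f.
  by rewrite size_map_poly_id0 // (monicP mf) rmorph1 oner_neq0.
have f_gt0 : (0 < size f)%N by rewrite size_poly_gt0 monic_neq0.
pose band d r := lin1_mx (poly_rV \o r \o* rVpoly) :
  'M[F]_(d, (size g).-1 + (size f).-1).
have -> : map_mx h (Sylvester_mx f g) = col_mx (band _ f') (band _ g').
  apply/matrixP=> i j; rewrite mxE Sylvester_mxE mxE.
  by case: split => k; rewrite !mxE /= rVpoly_delta coefXnM ltnNge;
     case: (_ <= _)%N; rewrite ?rmorph0 //= coef_map.
rewrite -[uv]hsubmxK mul_row_col !mul_rV_lin1 /= in nz_uv *.
set u := rVpoly _; set v := rVpoly _ => uv0; apply/negP => co_fg.
have vg_uf : u * f' + v * g' = 0.
  move/(congr1 rVpoly): uv0; rewrite -linearD linear0 poly_rV_K //.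
  have sz_g' : (size g' <= size g)%N := size_poly _ _.
  rewrite (leq_trans (size_polyD _ _)) // geq_max.
  rewrite !(leq_trans (size_polyMleq _ _)) // -subn1 leq_subLR.
    rewrite addnA addnC leq_add ?size_poly // (leq_trans sz_g') //.
    by rewrite add1n leqSpred.
  by rewrite sz_f' addnCA leq_add ?size_poly // add1n leqSpred.
(* f' divides v g', hence v, which has smaller degree. *)
have v0 : v = 0.
  apply/eqP/negP=> /negP nz_v.
  suff: f' %| v.
    move=> /(dvdp_leq nz_v); rewrite sz_f' => /leq_trans/(_ (size_poly _ _)).
    by rewrite -{1}(prednK f_gt0) ltnn.
  rewrite -(Gauss_dvdpl _ co_fg) -(dvdp_addr _ (dvdp_mull u (dvdpp f'))).
  by rewrite vg_uf dvdp0.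
have nz_f' : f' != 0 by rewrite -size_poly_gt0 sz_f'.
have u0 : u = 0.
  apply/eqP; move/eqP: vg_uf.
  by rewrite v0 mul0r addr0 mulf_eq0 (negPf nz_f') orbF.
case/eqP: nz_uv; rewrite -[lsubmx uv]rVpolyK -[rsubmx uv]rVpolyK -/u -/v.
by rewrite u0 v0 !linear0 row_mx0.
Qed.

(** In the direction that assumes the discriminant invertible modulo p,
separability follows from the Bezout identity expressing the resultant. *)
Lemma dvdz_disc (p : nat) (f : {poly int}) : prime p ->
    f \is monic -> (1 < size f)%N ->
  (p%:Z %| disc f)%Z = ~~ separable_poly (reduce_mod p f).
Proof.
move=> p_pr mf f_gt1; rewrite -intr_Fp_eq0 // unlock deriv_map.
apply/eqP/idP=> [disc0|].
  by apply: det_map_Sylvester_eq0 => //; rewrite det_map_mx.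
apply: contraNeq => disc_n0; have [f'_gt1|f'_le1] := ltnP 1 (size f^`()).
  have [[u v] _ /= res_uv] := resultant_in_ideal f_gt1 f'_gt1.
  have {}res_uv : reduce_mod p u * reduce_mod p f +
      reduce_mod p v * reduce_mod p f^`() = ((disc f)%:~R : 'F_p)%:P.
    by rewrite /reduce_mod -!rmorphM -rmorphD -res_uv /= map_polyC.
  apply/Bezout_eq1_coprimepP.
  pose c := ((disc f)%:~R : 'F_p)^-1%:P.
  exists (c * reduce_mod p u, c * reduce_mod p v) => /=.
  by rewrite -!mulrA -mulrDr res_uv -polyCM mulVf.
(* A derivative of degree 0 over Z means that f has degree 1, with f' = 1. *)
case sz_f: (size f) f_gt1 => [|[|m]] // _.
have f'_m : f^`()`_m = m.+1%:R.
  by rewrite coef_deriv -[f`_m.+1]/(f`_m.+2.-1) -sz_f -lead_coefE (monicP mf).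
have m0 : m = 0.
  apply/eqP; rewrite -leqn0 -ltnS (leq_trans _ f'_le1) // ltnNge.
  apply/negP=> /(nth_default 0) /eqP; rewrite f'_m.
  by rewrite pnatr_eq0.
move: f'_m; rewrite m0 [f^`()]size1_polyC // coefC /= => ->.
by rewrite map_polyC /= rmorph1 coprimep1.
Qed.

Lemma deriv_prod (R : comNzRingType) (I : eqType) (r : seq I)
    (F : I -> {poly R}) : uniq r ->
  (\prod_(j <- r) F j)^`() =
    \sum_(i <- r) \prod_(j <- r) if j == i then (F j)^`() else F j.
Proof.
elim: r => [|x r IHr] /=; first by rewrite !big_nil derivC.
case/andP=> r'x /IHr{}IHr; rewrite !big_cons derivM IHr eqxx mulr_sumr.
congr (_ * _ + _).
  by apply: eq_big_seq => j jr; case: eqP jr r'x => // -> ->.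
apply: eq_big_seq => i ir; rewrite big_cons.
by case: eqP ir r'x => // -> ->.
Qed.

(** The Leibniz rule applied to each term of the determinant; the derivative
falls on one row at a time. *)
Lemma deriv_det (R : comNzRingType) n (A : 'M[{poly R}]_n) :
  (\det A)^`() =
    \sum_i \det (\matrix_(k, j) if k == i then (A k j)^`() else A k j).
Proof.
rewrite /determinant exchange_big raddf_sum; apply: eq_bigr => s _ /=.
rewrite -mulr_sumr.
rewrite derivM -(rmorph_sign polyC) derivC mul0r add0r.
rewrite deriv_prod ?index_enum_uniq //; congr (_ * _).
by apply: eq_bigr => i _; apply: eq_bigr => k _; rewrite mxE.
Qed.

Lemma dvdp_det_sub (F : fieldType) (d : {poly F}) n (A B : 'M[{poly F}]_n) :
  (forall i j, d %| A i j - B i j) -> d %| \det A - \det B.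
Proof.
move=> d_AB; rewrite /determinant -sumrB.
elim/big_rec: _ => [|s x _ d_x]; first exact: dvdp0.
rewrite dvdp_addl // -mulrBr dvdp_mull //.
elim/big_rec2: _ => [|i x' y _ d_xy]; first by rewrite subrr dvdp0.
have -> : A i (s i) * y - B i (s i) * x' =
  (A i (s i) - B i (s i)) * y + B i (s i) * (y - x').
  by rewrite mulrBl mulrBr addrA subrK.
exact: dvdp_add (dvdp_mulr _ (d_AB _ _)) (dvdp_mull _ d_xy).
Qed.

(** The i-th summand is the i-th principal minor of xI - M, written as the
determinant of an n by n matrix. It is the derivative of the determinant in the
i-th column, as the derivative of xI - M is the identity. *)
Lemma deriv_char_poly n (M : 'M[int]_n) :
  (char_poly M)^`() = \sum_i \det
    (\matrix_(k, j) if j == i then (k == i)%:R else char_poly_mx M k j).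
Proof.
rewrite /char_poly -det_tr deriv_det; apply: eq_bigr => i _.
rewrite -[RHS]det_tr; congr (\det _); apply/matrixP => k j; rewrite !mxE.
case: eqP => [->|//]; rewrite eq_sym.
by case: eqP => _; rewrite derivE ?derivX ?derivC ?subr0 // derivC.
Qed.

(** * Linear maps, quotient modules and tensor products *)

Section Modules.
Variable R : pzRingType.

Lemma ex_linear (V W : lmodType R) (f : V -> W) :
  linear f -> exists g : {linear V -> W}, g =1 f.
Proof.
move=> f_lin.
pose g : {linear V -> W} := HB.pack f (GRing.isLinear.Build R V W *:%R f f_lin).
by exists g.
Qed.

Lemma factor_surjection (U V W : lmodType R)
    (g : {linear U -> V}) (h : {linear U -> W}) :
    (forall v, exists u, g u = v) -> (forall u, g u = 0 -> h u = 0) ->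
  exists f : {linear V -> W}, forall u, f (g u) = h u.
Proof.
move=> /choice[s gs] ker_gh.
have gh u u' : g u = g u' -> h u = h u'.
  by move/eqP; rewrite -subr_eq0 -raddfB => /eqP/ker_gh/eqP;
     rewrite raddfB subr_eq0 => /eqP.
have [|f fE] := @ex_linear V W (h \o s).
  by move=> a u v /=; rewrite -linearP; apply: gh; rewrite linearP !gs.
by exists f => u; rewrite fE; apply: gh; rewrite gs.
Qed.

(** Both modules are quotients of U by the same kernel. *)
Lemma liso_common_cover (U V W : lmodType R)
    (g : {linear U -> V}) (h : {linear U -> W}) :
    (forall v, exists u, g u = v) -> (forall w, exists u, h u = w) ->
    (forall u, g u = 0 <-> h u = 0) ->
  liso V W.
Proof.
move=> g_surj h_surj ker_gh.
have [u /ker_gh//|f fE] := factor_surjection (h := h) g_surj.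
have [u /ker_gh//|f' f'E] := factor_surjection (h := g) h_surj.
exists f, f' => [v|w].
  by have [u <-] := g_surj v; rewrite fE f'E.
by have [u <-] := h_surj w; rewrite f'E fE.
Qed.

Lemma quotmod_lift (V W : lmodType R) (N : submodClosed V)
    (g : {linear V -> W}) : {in N, forall v, g v = 0} ->
  exists f : {linear quotmod N -> W}, forall v, f (quotpi N v) = g v.
Proof.
move=> gN; apply: factor_surjection => [x|v].
  by elim/quotpi_ind: x => v; exists v.
by rewrite -(raddf0 (quotpi N)) quotpi_eq subr0; apply: gN.
Qed.

Lemma lcoker_pi_eq0 (U V : lmodType R) (f : {linear U -> V}) v :
  quotpi (image_of f) v = 0 <-> exists u, v = f u.
Proof.
rewrite -(raddf0 (quotpi (image_of f))) quotpi_eq subr0.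
by split=> [/asboolP|fu] //; apply/asboolP.
Qed.

End Modules.

Section Tensor.
Variables (R : comNzRingType) (A B : lmodType R).

Definition tens (a : A) (b : B) : tensor A B :=
  quotpi (span_of (@tensor_relator R A B)) << (a, b) >>.

Lemma span_of_gen (V : lmodType R) (S : V -> Prop) v : S v -> v \in span_of S.
Proof.
move=> Sv; apply/asboolP; exists [:: (1, v)]; last by rewrite big_seq1 scale1r.
by move=> c /[!inE]/eqP->.
Qed.

Lemma tensDl a a' b : tens (a + a') b = tens a b + tens a' b.
Proof.
rewrite /tens -raddfD; apply/quotpi_eq; rewrite opprD addrA.
exact/span_of_gen/TensorAddl.
Qed.

Lemma tensDr a b b' : tens a (b + b') = tens a b + tens a b'.
Proof.
rewrite /tens -raddfD; apply/quotpi_eq; rewrite opprD addrA.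
exact/span_of_gen/TensorAddr.
Qed.

Lemma tensZl r a b : tens (r *: a) b = r *: tens a b.
Proof.
rewrite /tens -linearZ; apply/quotpi_eq; exact/span_of_gen/TensorScalel.
Qed.

Lemma tensZr r a b : tens a (r *: b) = r *: tens a b.
Proof.
rewrite /tens -linearZ; apply/quotpi_eq; exact/span_of_gen/TensorScaler.
Qed.

Lemma tens0l b : tens 0 b = 0.
Proof. by rewrite -(scale0r 0) tensZl scale0r. Qed.

Lemma freegZU (K : choiceType) (c k : R) (x : K) :
  c *: << k *g x >> = << c * k *g x >> :> {freeg K / R}.
Proof. by apply/eqP/freeg_eqP => y; rewrite coeffZ !coeffU mulrA. Qed.

Lemma freeg_basis_ind (K : choiceType) (P : {freeg K / R} -> Prop) :
  (forall u v, P u -> P v -> P (u + v)) -> (forall c x, P (c *: << x >>)) ->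
  P 0 -> forall D, P D.
Proof.
move=> PD PZ P0 D; rewrite -(freeg_sumE D); elim/big_rec: _ => // x u _ Pu.
by apply: PD => //; rewrite -[coeff x D]mulr1 -freegZU.
Qed.

Lemma fglift_is_linear (K : choiceType) (M : lmodType R) (f : K -> M) :
  linear (fglift f).
Proof.
have fgB := lift_is_additive f.
have fg0 : fglift f 0 = 0 by rewrite -(subrr 0) fgB subrr.
have fgD : {morph fglift f : u v / u + v}.
  by move=> u v; rewrite -{1}[v]opprK fgB -{1}[- v]add0r fgB fg0 sub0r opprK.
move=> c u v; rewrite fgD; congr (_ + _).
elim/freeg_basis_ind: u => [u w IHu IHw|k x|].
- by rewrite scalerDr !fgD IHu IHw scalerDr.
- by rewrite scalerA !freegZU !mulr1 !liftU scalerA.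
by rewrite scaler0 fg0 scaler0.
Qed.

(** Coefficients can be absorbed into the first factor, so the pure tensors span
the tensor product additively. *)
Lemma tensor_ind (P : tensor A B -> Prop) :
    (forall u v, P u -> P v -> P (u + v)) -> (forall a b, P (tens a b)) ->
  forall t, P t.
Proof.
move=> PD Pt; elim/quotpi_ind; elim/freeg_basis_ind => [u v Pu Pv|r [a b]|].
- by rewrite raddfD; apply: PD.
- by rewrite linearZ /= -/(tens a b) -tensZl.
by rewrite raddf0 -(tens0l 0).
Qed.

(** The universal property of the tensor product. *)
Lemma tensor_lift (W : lmodType R) (phi : A -> B -> W) :
    (forall b, linear (phi^~ b)) -> (forall a, linear (phi a)) ->
  exists f : {linear tensor A B -> W}, forall a b, f (tens a b) = phi a b.
Proof.
move=> phil phir.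
have [g gE] := ex_linear (fglift_is_linear (fun c => phi c.1 c.2)).
have gU a b : g << (a, b) >> = phi a b by rewrite gE liftU scale1r.
have phiDl a a' b : phi (a + a') b = phi a b + phi a' b.
  by rewrite -[a]scale1r phil !scale1r.
have phiDr a b b' : phi a (b + b') = phi a b + phi a b'.
  by rewrite -[b]scale1r phir !scale1r.
have phi0l b : phi 0 b = 0.
  by apply: (addrI (phi 0 b)); rewrite -phiDl !addr0.
have phi0r a : phi a 0 = 0.
  by apply: (addrI (phi a 0)); rewrite -phiDr !addr0.
have phiZl r a b : phi (r *: a) b = r *: phi a b.
  by rewrite -[r *: a]addr0 phil /= phi0l addr0.
have phiZr r a b : phi a (r *: b) = r *: phi a b.
  by rewrite -[r *: b]addr0 phir phi0r addr0.
have [|f fE] := @quotmod_lift _ _ W (span_of (@tensor_relator R A B)) g.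
  move=> v /asboolP[s Ss ->]; rewrite linear_sum big_seq big1 // => c /Ss rel_c.
  rewrite linearZ /=; apply/eqP; rewrite -[X in _ == X](scaler0 _ c.1).
  apply/eqP; congr (_ *: _).
  case: rel_c => [a a' b|a b b'|r a b|r a b];
    rewrite !linearB /= ?linearZ /= !gU.
  - by rewrite phiDl addrAC addrK subrr.
  - by rewrite phiDr addrAC addrK subrr.
  - by rewrite phiZl scalerN subrr.
  by rewrite phiZr scalerN subrr.
by exists f => a b; rewrite fE gU.
Qed.

End Tensor.

(** * Adic completions *)

Section Completion.
Variable A : comNzRingType.

Lemma ideal_pow_mul (I : {pred A}) k a b :
  a \in I -> b \in ideal_pow I k -> a * b \in ideal_pow I k.+1.
Proof. by move=> Ia Ib; apply: (@span_of_gen A A^o); exists a, b. Qed.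

Lemma ideal_pow_expr (I : {pred A}) k a : a \in I -> a ^+ k \in ideal_pow I k.
Proof.
by move=> Ia; elim: k => // k IHk; rewrite exprS ideal_pow_mul.
Qed.

Section Trunc.
Variable I : {pred A}.

(** A lift to A of the projection of the completion to A / I^k. It depends on
the representative chosen for x, so it is additive and A-linear only modulo
I^k. *)
Definition trunc k (x : completion I) : A := repr x k.

Lemma trunc_pi k f : trunc k (clspi f : completion I) - f k \in ideal_pow I k.
Proof.
rewrite /trunc; move: k; apply/clspi_eq; exact: reprK.
Qed.

Lemma ideal_powB k a b : a \in ideal_pow I k -> b \in ideal_pow I k ->
  a - b \in ideal_pow I k.
Proof. by move=> Ia Ib; rewrite ideal_powD ?ideal_powN. Qed.

Lemma truncD k x y :
  trunc k (x + y) - (trunc k x + trunc k y) \in ideal_pow I k.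
Proof.
elim/clspi_ind: x => f; elim/clspi_ind: y => g; rewrite -raddfD.
have regroup (a b c u v : A) : a - (b + c) = a - (u + v) - (b - u) - (c - v).
  by ring.
rewrite (regroup _ _ _ (f k) (g k)) ideal_powB ?trunc_pi //.
by rewrite ideal_powB ?trunc_pi // (trunc_pi k (f + g)).
Qed.

Lemma truncM k a x :
  trunc k (to_completion I a * x) - a * trunc k x \in ideal_pow I k.
Proof.
elim/clspi_ind: x => f; set ca := CohSeq (const_coherent I a).
rewrite -[to_completion I a]/(clspi ca) -(rmorphM (@clspi A I)).
have regroup (b c u : A) : b - a * c = b - a * u - a * (c - u) by ring.
rewrite (regroup _ _ (f k)) ideal_powB ?ideal_powM ?trunc_pi //.
Qed.

Lemma trunc1 k : trunc k (1 : completion I) - 1 \in ideal_pow I k.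
Proof. by rewrite -(rmorph1 (@clspi A I)) trunc_pi. Qed.

(** The inverse of 1 - t is the class of the partial sums of its geometric
series. *)
Lemma completion_unit t : t \in I ->
  exists s, to_completion I (1 - t) * s = 1.
Proof.
move=> It; pose s k := \sum_(i < k) t ^+ i.
have coh_s : s \in coherent I.
  apply/asboolP => k; rewrite /s big_ord_recr /= addrAC subrr add0r.
  exact: ideal_pow_expr.
exists (clspi (CohSeq coh_s)).
rewrite -(rmorphM (@clspi A I)) -(rmorph1 (@clspi A I)).
apply/clspi_eq => k; change ((1 - t) * s k - 1 \in ideal_pow I k).
have -> : (1 - t) * s k - 1 = - t ^+ k.
  by rewrite -[1 - t]opprB mulNr -subrX1 opprB addrAC subrr add0r.
by rewrite ideal_powN // ideal_pow_expr.
Qed.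

End Trunc.

Section TwoGenerators.
Variables (g1 g2 : A).
Let I := ideal_gen (fun c => c = g1 \/ c = g2).

Lemma ideal_gen2P x : x \in I <-> exists u v, x = u * g1 + v * g2.
Proof.
split=> [/asboolP[s Ss ->]|[u [v ->]]].
  elim: s Ss => [|c s IHs] Ss.
    by exists 0, 0; rewrite big_nil !mul0r addr0.
  rewrite big_cons; have [d ds|u [v ->]] := IHs.
    by apply: Ss; rewrite inE ds orbT.
  have [->|->] := Ss c (mem_head _ _).
    by exists (c.1 + u), v; rewrite mulrDl addrA.
  by exists u, (c.1 + v); rewrite mulrDl addrCA.
have [_ clI] := @span_of_submod_closed A A^o (fun c => c = g1 \/ c = g2).
apply: clI; first by apply: (@span_of_gen A A^o); left.
have [I0 clI] := @span_of_submod_closed A A^o (fun c => c = g1 \/ c = g2).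
by rewrite -[v * g2]addr0; apply: clI => //; apply: (@span_of_gen A A^o); right.
Qed.

Lemma ideal_powS_gen2 k x : x \in ideal_pow I k.+1 ->
  exists y z,
    [/\ y \in ideal_pow I k, z \in ideal_pow I k & x = g1 * y + g2 * z].
Proof.
move=> /asboolP[s Ss ->].
elim: s Ss => [|c s IHs] Ss.
  by exists 0, 0; rewrite !ideal_pow0 big_nil !mulr0 addr0.
rewrite big_cons; have [d ds|y [z [Iy Iz ->]]] := IHs.
  by apply: Ss; rewrite inE ds orbT.
have [a [b [/ideal_gen2P[u [v ->]] Ib ->]]] := Ss c (mem_head _ _).
exists (c.1 * u * b + y), (c.1 * v * b + z).
rewrite !ideal_powD ?ideal_powM //; split=> //.
rewrite -[c.1 *: _]/(c.1 * _); ring.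
Qed.

(** Writing each difference of consecutive terms of a coherent sequence f as
g1 y_k + g2 z_k with y_k and z_k in the preceding power of I, the series of the
y_k and of the z_k converge; the class of f is f 1 plus g1 and g2 times their
sums. The decomposition starts at f 1, as f 1 - f 0 need not be in I. *)
Lemma completion_decomp (r : completion I) : exists a r1 r2,
  r = to_completion I a + to_completion I g1 * r1 + to_completion I g2 * r2.
Proof.
elim/clspi_ind: r => f.
have /asboolP coh_f : cohseq_val f \in coherent I by case: f.
have /choice[yz yzP] k : exists yz : A * A, [/\ yz.1 \in ideal_pow I k,
    yz.2 \in ideal_pow I k & f k.+2 - f k.+1 = g1 * yz.1 + g2 * yz.2].
  by have [y [z yzP]] := ideal_powS_gen2 (coh_f k.+1); exists (y, z).
pose s1 k := \sum_(i < k) (yz i).1; pose s2 k := \sum_(i < k) (yz i).2.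
have coh1 : s1 \in coherent I.
  apply/asboolP => k; rewrite /s1 big_ord_recr /= addrAC subrr add0r.
  by have [] := yzP k.
have coh2 : s2 \in coherent I.
  apply/asboolP => k; rewrite /s2 big_ord_recr /= addrAC subrr add0r.
  by have [] := yzP k.
have fE k : f k.+1 = f 1 + g1 * s1 k + g2 * s2 k.
  elim: k => [|k IHk]; first by rewrite /s1 /s2 !big_ord0 !mulr0 !addr0.
  have [_ _] := yzP k => /eqP; rewrite subr_eq => /eqP->; rewrite IHk.
  rewrite /s1 /s2 !big_ord_recr /=; ring.
exists (f 1), (clspi (CohSeq coh1)), (clspi (CohSeq coh2)).
rewrite -!(rmorphM (@clspi A I)) -!(rmorphD (@clspi A I)); apply/clspi_eq => k.
change (f k - (f 1 + g1 * s1 k + g2 * s2 k) \in ideal_pow I k).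
rewrite -fE -opprB.
by rewrite ideal_powN // coh_f.
Qed.

End TwoGenerators.

End Completion.

(** * Base change followed by reduction modulo an element *)

Section ModScale.
Variables (R : comNzRingType) (c : R) (V : lmodType R).

Definition modscale_pi (v : V) : modscale c V :=
  quotpi (image_of (GRing.scale c : {linear V -> V})) v.

Lemma modscale_pi_linear : linear modscale_pi.
Proof. by move=> a u v; rewrite /modscale_pi linearP. Qed.

Lemma modscale_piD u v : modscale_pi (u + v) = modscale_pi u + modscale_pi v.
Proof. by rewrite /modscale_pi raddfD. Qed.

Lemma modscale_piZ a v : modscale_pi (a *: v) = a *: modscale_pi v.
Proof. by rewrite /modscale_pi linearZ. Qed.

Lemma modscale_pi_eq0 v : modscale_pi v = 0 <-> exists u, v = c *: u.
Proof. exact: lcoker_pi_eq0. Qed.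

Lemma modscale_ind (P : modscale c V -> Prop) :
  (forall v, P (modscale_pi v)) -> forall x, P x.
Proof. exact: quotpi_ind. Qed.

Lemma modscale_kill (x : modscale c V) : c *: x = 0.
Proof.
by elim/modscale_ind: x => v; rewrite -modscale_piZ modscale_pi_eq0; exists v.
Qed.

End ModScale.

Section BaseChange.
Variables (R : comNzRingType) (S : comPzRingType) (f : {rmorphism R -> S}).
Variables (c : R) (N : lmodType R).

(** The properties of x, s |-> x (x) s, as a map from N and S to (N (x) S) / c,
from which the structure of the quotient is derived. *)
Record balanced_cover (V : lmodType R) (q : N -> S -> V) : Prop :=
    BalancedCover {
  balDl : forall x y s, q (x + y) s = q x s + q y s;
  balDr : forall x s t, q x (s + t) = q x s + q x t;
  balZl : forall a x s, q (a *: x) s = a *: q x s;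
  balZr : forall a x s, q x (f a * s) = a *: q x s;
  bal_ind : forall P : V -> Prop, (forall u v, P u -> P v -> P (u + v)) ->
    (forall x s, P (q x s)) -> forall v, P v;
  bal_kill : forall v : V, c *: v = 0
}.

Definition base_change : lmodType R := tensor N (restrict_scalars S^o f).

Local Notation T := base_change.

Definition qtens (x : N) (s : S) : modscale c T :=
  modscale_pi c (tens x (s : restrict_scalars S^o f)).

Lemma qtens_balanced : balanced_cover qtens.
Proof.
split.
- by move=> x y s; rewrite /qtens -modscale_piD -tensDl.
- by move=> x s t; rewrite /qtens -modscale_piD -tensDr.
- by move=> a x s; rewrite /qtens -modscale_piZ -tensZl.
- by move=> a x s; rewrite /qtens -modscale_piZ -tensZr.
- move=> P PD Pq; elim/modscale_ind; elim/tensor_ind => [u v Pu Pv|x s].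
    by rewrite modscale_piD; apply: PD.
  exact: Pq.
exact: modscale_kill.
Qed.

(** The map tau is an R-linear retraction of f up to scalars that kill W, such
as a truncation of a completion. Then x (x) s |-> tau(s) rho(x) is a well-defined
linear map to W, which sends x (x) 1 to rho(x). *)
Lemma qtens1_eq0 (W : lmodType R) (rho : {linear N -> W}) (tau : S -> R) :
    (forall w : W, c *: w = 0) -> (forall w : W, tau 1 *: w = w) ->
    (forall s t (w : W), tau (s + t) *: w = tau s *: w + tau t *: w) ->
    (forall a s (w : W), tau (f a * s) *: w = a *: (tau s *: w)) ->
  forall x, qtens x 1 = 0 -> rho x = 0.
Proof.
move=> cW tau1 tauD tauM x /modscale_pi_eq0[t x1_ct].
have [||g gE] := @tensor_lift R N (restrict_scalars S^o f) W
    (fun x s => tau s *: rho x).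
- by move=> s a y z; rewrite linearP scalerDr !scalerA mulrC.
- by move=> y a s r; rewrite tauD (tauM a s).
by rewrite -[rho x]tau1 -gE x1_ct linearZ /= cW.
Qed.

Variables (V : lmodType R) (q : N -> S -> V).
Hypothesis qV : balanced_cover q.

(** A scalar that becomes a unit in S can be moved into the first factor. *)
Lemma bal_absorb_unit a s x r : f a * s = 1 -> q x r = q (a *: x) (s * r).
Proof. by move=> s1; rewrite (balZl qV) -(balZr qV) mulrA s1 mul1r. Qed.

Lemma bal0l s : q 0 s = 0.
Proof. by rewrite -(scale0r 0) (balZl qV) scale0r. Qed.

(** In x (x) r the unit g can be moved to x, and b g x is a multiple of c. *)
Lemma base_change_kill (phi b g d : R) (s : S) :
    (forall x : N, phi *: x = 0) -> phi = b * g + c * d -> f g * s = 1 ->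
  forall v : V, b *: v = 0.
Proof.
move=> phiN phi_bg s1; elim/(bal_ind qV) => [u v bu bv|x r].
  by rewrite scalerDr bu bv addr0.
rewrite (bal_absorb_unit _ _ s1) (balZl qV) scalerA -[b * g](addrK (c * d)).
by rewrite -phi_bg scalerBl -scalerA (bal_kill qV) subr0 -(balZl qV) phiN bal0l.
Qed.

(** In x (x) r the unit m can be moved to x, which gives a tensor e (x) r'; the
parts of r' in c S and b S contribute nothing. *)
Lemma base_change_cyclic (b m : R) (s : S) (e : N) :
    (forall r : S, exists a r1 r2, r = f a + f c * r1 + f b * r2) ->
    (forall v : V, b *: v = 0) ->
    f m * s = 1 -> (forall x : N, exists a, m *: x = a *: e) ->
  forall v, exists a, v = a *: q e 1.
Proof.
move=> decS bV s1 Ne; elim/(bal_ind qV) => [u v [a ->] [a' ->]|x r].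
  by exists (a + a'); rewrite scalerDl.
have [w wE] := Ne x; rewrite (bal_absorb_unit _ _ s1) wE (balZl qV) -(balZr qV).
have [a [r1 [r2 ->]]] := decS (f w * (s * r)).
exists a; rewrite !(balDr qV) -{1}[f a]mulr1 !(balZr qV) (bal_kill qV) bV.
by rewrite !addr0.
Qed.

End BaseChange.

Lemma liso_zero (R : comNzRingType) (V : lmodType R) :
  (forall v : V, v = 0) -> liso V 'cV[R]_0.
Proof.
move=> V0; have [|f _] := @ex_linear _ V 'cV[R]_0 (fun=> 0).
  by move=> a u v; rewrite scaler0 addr0.
by exists f, (fun=> 0) => [v|w]; [rewrite [v]V0 | rewrite linear0 [w]flatmx0].
Qed.

(** For the reduction of Z[x] modulo p, this presents F_p[x] / beta as a quotient
of Z[x]. *)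
Lemma residue_map (R S : comNzRingType) (g : {rmorphism R -> S}) (b : R) :
    (forall s, exists a, g a = s) ->
  exists h : {linear R^o -> modscale b (restrict_scalars S^o g)},
    (forall x, exists a, h a = x) /\
    (forall a, h a = 0 <-> exists s, g a = g b * s).
Proof.
move=> g_surj; set B := restrict_scalars S^o g.
have [|h hE] := @ex_linear R R^o (modscale b B)
    (fun a => modscale_pi b (g a : B)).
  by move=> a u v; rewrite -modscale_pi_linear; congr modscale_pi;
     rewrite [LHS]rmorphD rmorphM.
exists h; split=> [x|a]; last by rewrite hE modscale_pi_eq0.
by elim/modscale_ind: x => s; have [a <-] := g_surj s; exists a; rewrite hE.
Qed.

(** Here F is R / J for a maximal ideal J; maximality is expressed by J_inv. *)
Section ResidueModule.
Variables (R : comNzRingType) (F : lmodType R) (h : {linear R^o -> F}).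
Variable J : pred R.
Hypothesis h_surj : forall x, exists a, h a = x.
Hypothesis h_ker : forall a, h a = 0 <-> J a.
Hypothesis J_inv : forall a, ~~ J a -> exists u, J (1 - u * a).

(** A cyclic module killed by a maximal ideal is zero or the residue field. *)
Lemma liso_residue (V : lmodType R) (q0 : V) :
    (forall v, exists a, v = a *: q0) -> (forall a, J a -> a *: q0 = 0) ->
  liso V 'cV[R]_0 \/ liso V F.
Proof.
move=> V_cyc killed; have [q0_0|/eqP q0_n0] := pselect (q0 = 0).
  by left; apply: liso_zero => v; have [a ->] := V_cyc v; rewrite q0_0 scaler0.
right; have [|g gE] := @ex_linear _ R^o V (fun a => a *: q0).
  by move=> a u v; rewrite scalerDl scalerA.
apply: (liso_common_cover (g := g) (h := h)) => [v|//|a].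
  by have [a ->] := V_cyc v; exists a; rewrite gE.
rewrite gE h_ker; split=> [a0|]; last exact: killed.
have [//|/J_inv[u /killed]] := boolP (J a).
rewrite scalerBl scale1r -scalerA a0 scaler0 subr0 => q0_0.
by rewrite q0_0 eqxx in q0_n0.
Qed.

(** In a vector space of dimension at most one over R / J, a family is zero or
consists of multiples of one of its nonzero members. *)
Lemma liso_residue_family (V : lmodType R) (b : R) (I : finType) (q : I -> V) :
    J b -> liso V 'cV[R]_0 \/ liso V F ->
  (forall j, q j = 0) \/
  exists i (a : I -> R), b *: q i = 0 /\ forall j, q j = a j *: q i.
Proof.
move=> Jb [[psi /bij_inj psi_inj]|[psi /bij_inj psi_inj]].
  by left=> j; apply: psi_inj; rewrite [LHS]flatmx0 [RHS]flatmx0.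
have hM x y : h (x * y) = x *: h y by rewrite -linearZ.
have /choice[c cE] j : exists c, h c = psi (q j) by exact: h_surj.
have [q0|/existsNP[i qi_n0]] := pselect (forall j, q j = 0); first by left.
have [|u /h_ker hu] := @J_inv (c i).
  apply: contra_notN qi_n0 => /h_ker; rewrite cE -[0](raddf0 psi).
  exact: psi_inj.
right; exists i, (fun j => c j * u); split=> [|j]; apply: psi_inj.
  rewrite linearZ raddf0 -cE /= -hM mulrC hM.
  by have /h_ker -> := Jb; rewrite scaler0.
have decomp : c j - c j * u * c i = c j * (1 - u * c i) :> R.
  by rewrite mulrBr mulr1 mulrA.
rewrite linearZ /= -!cE -hM; apply/eqP; rewrite -subr_eq0 -linearB.
by apply/eqP; rewrite [X in h X]decomp hM hu scaler0.
Qed.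

Section BaseChange.
Variables (S : comPzRingType) (f : {rmorphism R -> S}) (b c : R).
Hypothesis J_gen : forall a, J a -> exists u v, a = b * u + c * v.
Hypothesis f_unit : forall a, ~~ J a -> exists s, f a * s = 1.
Hypothesis f_dec : forall r, exists a r1 r2, r = f a + f c * r1 + f b * r2.
Variables (N V : lmodType R) (q : N -> S -> V) (phi : R).
Hypothesis qV : balanced_cover f c q.
Hypothesis phiN : forall x : N, phi *: x = 0.

Lemma liso_base_change_unit : ~~ J phi -> liso V 'cV[R]_0.
Proof.
move=> /f_unit[s s1]; apply: liso_zero => v; rewrite -[v]scale1r.
apply: (base_change_kill qV (b := 1) (d := 0) phiN _ s1).
by rewrite mul1r mulr0 addr0.
Qed.

Lemma liso_base_change_residue (g d m : R) (e : N) :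
    phi = b * g + c * d -> ~~ J g ->
    ~~ J m -> (forall x : N, exists a, m *: x = a *: e) ->
  liso V 'cV[R]_0 \/ liso V F.
Proof.
move=> phi_bg /f_unit[s s1] /f_unit[t t1] Ne.
have bV := base_change_kill qV phiN phi_bg s1.
apply: (liso_residue (base_change_cyclic qV f_dec bV t1 Ne)).
move=> a /J_gen[u [v ->]].
by rewrite scalerDl -!scalerA bV (bal_kill qV) addr0.
Qed.

End BaseChange.
End ResidueModule.

(** * Vanishing of elements x (x) 1 for the cokernel of a matrix *)

Lemma ideal_pow2_gen2 (A : comNzRingType) (g1 g2 x : A) :
    x \in ideal_pow (ideal_gen (fun c => c = g1 \/ c = g2)) 2 ->
  exists u v, x = g1 * u + g2 ^+ 2 * v.
Proof.
move=> /ideal_powS_gen2[y [z [_ /ideal_powS_gen2[y' [z' [_ _ ->]]] ->]]].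
by exists (y + g2 * y'), z'; ring.
Qed.

(** The map tau induces an R-linear map S -> R / (g1, g2) sending 1 to 1. Hence
N (x) S maps to the cokernel of P over R / (g1, g2), and v (x) 1 is sent to the
class of v. *)
Lemma qtens_cokernel_eq0 (R : comNzRingType) (S : comPzRingType)
    (f : {rmorphism R -> S}) (tau : S -> R) (g1 g2 : R) (n m : nat)
    (P : 'M[R]_(n, m)) (N : lmodType R) (pi : 'cV_n -> N) v :
    let K x := exists u v, x = g1 * u + g2 * v in
    K (tau 1 - 1) -> (forall s t, K (tau (s + t) - (tau s + tau t))) ->
    (forall a s, K (tau (f a * s) - a * tau s)) ->
    linear pi -> (forall x, exists w, pi w = x) ->
    (forall w, pi w = 0 -> exists u, w = P *m u) ->
    qtens f g1 (pi v) 1 = 0 ->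
  exists u1 u2 u3, v = P *m u1 + g1 *: u2 + g2 *: u3.
Proof.
move=> K tau1 tauD tauM /ex_linear[piN piE] pi_surj pi_ker v0.
pose L : 'M_(n, m + n + n) := row_mx (row_mx P g1%:M) g2%:M.
have LE u1 u2 u3 :
    L *m col_mx (col_mx u1 u2) u3 = P *m u1 + g1 *: u2 + g2 *: u3 :> 'cV_n.
  by rewrite !mul_row_col !mul_scalar_mx.
(* W is the cokernel of P over R / (g1, g2), presented over R. *)
pose W : lmodType R := lcoker (mulmx L : {linear 'cV_(m + n + n) -> 'cV_n}).
pose piW : {linear 'cV_n -> W} :=
  quotpi (image_of (mulmx L : {linear 'cV_(m + n + n) -> 'cV_n})).
have piW_eq0 w : piW w = 0 <-> exists u, w = L *m u by exact: lcoker_pi_eq0.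
have piW_surj (x : W) : exists w, piW w = x.
  by elim/quotpi_ind: x => w; exists w.
have [x|w|rho rhoE] := factor_surjection (g := piN) (h := piW).
- by have [w <-] := pi_surj x; exists w.
- rewrite piE => /pi_ker[u ->]; apply/piW_eq0.
  by exists (col_mx (col_mx u 0) 0); rewrite LE !scaler0 !addr0.
have g1W (x : W) : g1 *: x = 0.
  have [w <-] := piW_surj x; rewrite -linearZ; apply/piW_eq0.
  by exists (col_mx (col_mx 0 w) 0); rewrite LE mulmx0 scaler0 add0r addr0.
have g2W (x : W) : g2 *: x = 0.
  have [w <-] := piW_surj x; rewrite -linearZ; apply/piW_eq0.
  by exists (col_mx (col_mx 0 0) w); rewrite LE mulmx0 scaler0 !add0r.
have KW a b (x : W) : K (a - b) -> a *: x = b *: x.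
  move=> [y [z ab]]; apply/eqP; rewrite -subr_eq0 -scalerBl ab.
  by rewrite scalerDl -scalerA g1W -scalerA g2W addr0.
have : rho (pi v) = 0.
  apply: (qtens1_eq0 rho (tau := tau) _ _ _ _ v0) => [//|w|s t w|a s w].
  - by rewrite (KW _ 1) ?scale1r.
  - by rewrite -scalerDl; apply: KW.
  by rewrite scalerA; apply: KW.
rewrite -piE rhoE => /piW_eq0[u ->].
rewrite -[u]vsubmxK -[usubmx u]vsubmxK LE.
by exists (usubmx (usubmx u)), (dsubmx (usubmx u)), (dsubmx u).
Qed.

(** * The maximal ideal (p, beta) of Z[x] *)

Section ReduceMod.
Variable p : nat.
Local Notation red := (reduce_mod p).

Lemma reduce_modD a b : red (a + b) = red a + red b.
Proof. exact: rmorphD. Qed.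
Lemma reduce_modB a b : red (a - b) = red a - red b.
Proof. exact: rmorphB. Qed.
Lemma reduce_modM a b : red (a * b) = red a * red b.
Proof. exact: rmorphM. Qed.
Lemma reduce_mod1 : red 1 = 1.
Proof. exact: rmorph1. Qed.
Lemma reduce_mod_det n (E : 'M[{poly int}]_n) :
  red (\det E) = \det (map_mx red E).
Proof. by rewrite det_map_mx. Qed.
End ReduceMod.

Section Localization.
Variables (p : nat) (beta : {poly int}).
Hypotheses (p_prime : prime p).
Hypotheses (irr_beta : irreducible_poly (reduce_mod p beta)).

Lemma max_idealP a :
  a \in max_ideal p beta <-> reduce_mod p beta %| reduce_mod p a.
Proof.
rewrite dvdp_reduce_mod //; split=> [/ideal_gen2P[u [v ->]]|[c [d ->]]].
  by exists v, u; ring.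
by apply/ideal_gen2P; exists d, c; ring.
Qed.

Lemma inv_mod_max_ideal a : ~~ (reduce_mod p beta %| reduce_mod p a) ->
  exists b, 1 - b * a \in max_ideal p beta.
Proof.
rewrite -irreducible_poly_coprime // => /Bezout_eq1_coprimepP[[u v] /= uv1].
have [b [red_b _]] := monic_lift p_prime v; exists b; apply/max_idealP.
rewrite reduce_modB reduce_mod1 reduce_modM red_b -uv1 addrK.
exact: dvdp_mull.
Qed.

(** By maximality b a = 1 - t for some b and some t in (p, beta). *)
Lemma unit_in_Rpb a : ~~ (reduce_mod p beta %| reduce_mod p a) ->
  exists s : Rpb p beta, to_Rpb p beta a * s = 1.
Proof.
move=> /inv_mod_max_ideal[b /completion_unit[s]].
rewrite subKr => s1; exists (to_Rpb p beta b * s).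
by rewrite mulrA -rmorphM [a * b]mulrC.
Qed.

End Localization.

(** * The cokernel of M - xI when the reduction is separable *)

Section Cokernel.
Variables (n : nat) (M : 'M[int]_n).

Definition coker_pi (v : 'cV[{poly int}]_n) : coker_MxI M :=
  quotpi (image_of (mulmx (map_mx polyC M - 'X%:M) :
    {linear 'cV[{poly int}]_n -> 'cV_n})) v.

Lemma coker_piP a u v : coker_pi (a *: u + v) = a *: coker_pi u + coker_pi v.
Proof. by rewrite /coker_pi linearP. Qed.

Lemma coker_piZ a v : coker_pi (a *: v) = a *: coker_pi v.
Proof. by rewrite /coker_pi linearZ. Qed.

Lemma char_poly_mxN : char_poly_mx M = - (map_mx polyC M - 'X%:M).
Proof. by rewrite opprB. Qed.

Lemma coker_pi_char_poly_mx w : coker_pi (char_poly_mx M *m w) = 0.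
Proof.
by apply/lcoker_pi_eq0; exists (- w); rewrite /= mulmxN -mulNmx char_poly_mxN.
Qed.

Lemma coker_ind (P : coker_MxI M -> Prop) :
  (forall v, P (coker_pi v)) -> forall x, P x.
Proof. exact: quotpi_ind. Qed.

(** The Cramer rule: det(xI - M) v = (xI - M) adj(xI - M) v. *)
Lemma char_poly_kill (x : coker_MxI M) : char_poly M *: x = 0.
Proof.
elim/coker_ind: x => v; rewrite -coker_piZ.
by rewrite -mul_scalar_mx -mul_mx_adj -mulmxA coker_pi_char_poly_mx.
Qed.

Definition char_poly_mx_delta_col (i : 'I_n) : 'M[{poly int}]_n :=
  \matrix_(k, j) if j == i then (k == i)%:R else char_poly_mx M k j.

Lemma mul_char_poly_mx_delta_col i w :
  char_poly_mx_delta_col i *m w =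
  w i 0 *: delta_mx i 0 +
    char_poly_mx M *m (\col_j if j == i then 0 else w j 0).
Proof.
apply/colP => k; rewrite !mxE (bigD1 i) //= [in RHS](bigD1 i) //= !mxE !eqxx.
rewrite mulr0 add0r mulrC andbT; congr (_ + _); apply: eq_bigr => j /negPf j'i.
by rewrite !mxE j'i.
Qed.

(** The Cramer rule for the modified matrix D, whose column space is contained
in that of xI - M enlarged by the i-th basis vector: det(D) v = D (adj(D) v). *)
Lemma coker_minor_cyclic i (x : coker_MxI M) :
  exists a, \det (char_poly_mx_delta_col i) *: x = a *: coker_pi (delta_mx i 0).
Proof.
elim/coker_ind: x => v; set D := char_poly_mx_delta_col i.
exists ((\adj D *m v) i 0).
rewrite -coker_piZ -mul_scalar_mx -mul_mx_adj -mulmxA.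
by rewrite mul_char_poly_mx_delta_col coker_piP coker_pi_char_poly_mx addr0.
Qed.

End Cokernel.

Lemma loc_pbE p beta (N : lmodType {poly int}) :
  base_change (to_Rpb p beta) N = loc_pb p beta N :> lmodType {poly int}.
Proof.
have -> : loc_pb p beta N =
    tensor N (restrict_scalars (Rpb p beta)^o (to_Rpb p beta)) :> lmodType _.
  by reflexivity.
reflexivity.
Qed.

Section Forward.
Variables (n : nat) (M : 'M[int]_n) (p : nat) (beta : {poly int}).
Hypotheses (p_prime : prime p).
Hypotheses (irr_beta : irreducible_poly (reduce_mod p beta)).

Local Notation red := (reduce_mod p).
Local Notation Q := (modscale p%:R (loc_pb p beta (coker_MxI M))).
(** Membership of the ideal (p, beta). *)
Let J : pred {poly int} := fun a => red beta %| red a.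

Lemma residue_field_map : exists h : {linear {poly int}^o -> Fpx_mod p beta},
  (forall x, exists a, h a = x) /\ (forall a, h a = 0 <-> J a).
Proof.
have [|h [h_surj h_ker]] :=
    @residue_map {poly int} {poly 'F_p} (reduce_mod p) beta.
  by move=> s; have [a [red_a _]] := monic_lift p_prime s; exists a.
exists h; split=> [|a]; first exact: h_surj.
apply: iff_trans (h_ker a) _; rewrite /J; split=> [[s as_]|/dvdpP[s as_]].
  by have -> : red a = red beta * s := as_; exact: dvdp_mulr.
by exists s; rewrite mulrC.
Qed.

Lemma max_ideal_maximal a : ~~ J a -> exists u, J (1 - u * a).
Proof.
move=> /(inv_mod_max_ideal p_prime irr_beta)[u /max_idealP Ju].
by exists u; apply: Ju.
Qed.

Lemma max_ideal_generated a : J a -> exists u v, a = beta * u + p%:R * v.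
Proof. by move/dvdp_reduce_mod; apply. Qed.

Section Separable.
Hypothesis sep_M : separable_poly (red (char_poly M)).

Lemma char_poly_cofactor : J (char_poly M) ->
  exists c d, char_poly M = beta * c + p%:R * d /\ ~~ J c.
Proof.
move=> /(dvdp_reduce_mod p_prime)[c [d phi_cd]]; exists c, d; split=> //.
rewrite /J -irreducible_poly_coprime //; apply: (separable_coprime sep_M).
rewrite -reduce_modM; apply/dvdp_reduce_mod => //.
by exists 1, d; rewrite mulr1.
Qed.

(** Otherwise beta-bar would divide both the characteristic polynomial and the
sum of the minors, which is its derivative, contradicting separability. *)
Lemma minor_notin_max_ideal : J (char_poly M) ->
  exists i, ~~ J (\det (char_poly_mx_delta_col M i)).
Proof.
move=> b_phi.
apply/existsP; apply: contraT; rewrite negb_exists => /forallP/= all_D.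
have b_phi' : red beta %| (red (char_poly M))^`().
  rewrite deriv_map deriv_char_poly -/(red _).
  elim/big_rec: _ => [|i x _ bx]; first by rewrite /reduce_mod map_poly0 dvdp0.
  by rewrite reduce_modD dvdp_add //; have := all_D i; rewrite negbK.
move: (sep_M); rewrite unlock => /coprimepP/(_ _ b_phi b_phi') /eqp_size.
by rewrite size_poly1 => b1; have := irr_beta.1; rewrite b1.
Qed.

Lemma separable_loc_coker :
  liso Q 'cV[{poly int}]_0 \/ liso Q (Fpx_mod p beta).
Proof.
rewrite -loc_pbE.
have qV := @qtens_balanced _ _ (to_Rpb p beta) p%:R (coker_MxI M).
have phiN := @char_poly_kill n M.
have [h [h_surj h_ker]] := residue_field_map.
have f_unit := @unit_in_Rpb p beta p_prime irr_beta.
have f_dec := @completion_decomp _ p%:R beta.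
have [b_phi|b'phi] := boolP (J (char_poly M)); last first.
  left; exact: (liso_base_change_unit f_unit qV phiN b'phi).
have [g [d [phi_gd Jg]]] := char_poly_cofactor b_phi.
have [i Ji] := minor_notin_max_ideal b_phi.
exact: (liso_base_change_residue h_surj h_ker max_ideal_maximal
  max_ideal_generated f_unit f_dec qV phiN phi_gd Jg Ji
  (@coker_minor_cyclic n M i)).
Qed.

End Separable.
End Forward.

(** * The cokernel of M - xI at a square factor *)

Section Backward.
Variables (n : nat) (M : 'M[int]_n) (p : nat) (beta : {poly int}).
Hypotheses (p_prime : prime p).
Hypotheses (irr_beta : irreducible_poly (reduce_mod p beta)).
Hypothesis sq_beta : reduce_mod p beta ^+ 2 %| reduce_mod p (char_poly M).

Local Notation red := (reduce_mod p).
Let q (v : 'cV[{poly int}]_n) := qtens (to_Rpb p beta) p%:R (coker_pi M v) 1.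

(** The truncation of R at level 2 takes values modulo (p, beta)^2, which is
contained in (p, beta^2). *)
Lemma q_eq0 v : q v = 0 -> exists u1 u2 u3,
  v = char_poly_mx M *m u1 + p%:R *: u2 + beta ^+ 2 *: u3.
Proof.
move=> qv0; have ideal2 := @ideal_pow2_gen2 _ p%:R beta.
have [||||x|w|u1 [u2 [u3 ->]]] := @qtens_cokernel_eq0 {poly int} _
    (to_Rpb p beta) (trunc 2) p%:R (beta ^+ 2) n n (map_mx polyC M - 'X%:M)
    (coker_MxI M) (@coker_pi n M) v _ _ _ _ _ _ qv0.
- exact/ideal2/trunc1.
- by move=> s t; apply/ideal2/truncD.
- by move=> a s; apply/ideal2/truncM.
- exact: coker_piP.
- by elim/coker_ind: x => w; exists w.
- exact: (lcoker_pi_eq0 _ _).1.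
exists (- u1), u2, u3.
by rewrite char_poly_mxN mulNmx mulmxN opprK.
Qed.

(** The columns of E are those of (xI - M) Y for some Y, modulo (p, beta^2), so
det E is a multiple of the characteristic polynomial modulo (p, beta^2). *)
Lemma dvdp_det_relations (E : 'M[{poly int}]_n) :
  (forall j, q (col j E) = 0) -> red beta ^+ 2 %| red (\det E).
Proof.
move=> qE.
have /choice[u uP] j : exists u, exists u2 u3,
    col j E = char_poly_mx M *m u + p%:R *: u2 + beta ^+ 2 *: u3.
  exact: q_eq0.
pose Y := \matrix_(k, j) u j k 0.
pose B := map_mx red (char_poly_mx M *m Y).
have bB : red beta ^+ 2 %| \det B.
  by rewrite -reduce_mod_det det_mulmx reduce_modM dvdp_mulr.
rewrite reduce_mod_det -(subrK (\det B) (\det (map_mx red E))).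
rewrite dvdp_add //; apply: dvdp_det_sub => k j.
rewrite /B [X in X - _]mxE [X in _ - X]mxE -reduce_modB.
rewrite expr2 -reduce_modM -expr2.
apply/dvdp_reduce_mod => //; have [u2 [u3 /colP/(_ k)]] := uP j.
have -> : (char_poly_mx M *m Y) k j = (char_poly_mx M *m u j) k 0.
  by rewrite !mxE; apply: eq_bigr => i _; rewrite [Y _ _]mxE.
rewrite [LHS]mxE => ->; exists (u3 k 0), (u2 k 0).
rewrite [X in X - _]mxE [X in X + _ - _]mxE [X in _ + X + _ - _]mxE.
rewrite [X in _ + X - _]mxE; ring.
Qed.

Lemma q_linear a u v : q (a *: u + v) = a *: q u + q v.
Proof.
have qV := @qtens_balanced _ _ (to_Rpb p beta) p%:R (coker_MxI M).
by rewrite /q coker_piP (balDl qV) (balZl qV).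
Qed.

Lemma not_liso_of_square :
  ~ (liso (modscale p%:R (loc_pb p beta (coker_MxI M))) 'cV[{poly int}]_0 \/
     liso (modscale p%:R (loc_pb p beta (coker_MxI M))) (Fpx_mod p beta)).
Proof.
have [h [h_surj h_ker]] := residue_field_map beta p_prime.
have sz_b : (1 < size (red beta))%N := irr_beta.1.
have Jbeta : red beta %| red beta by [].
have nz_b : red beta != 0 by rewrite -size_poly_gt0 ltnW.
have no_sq : ~ red beta ^+ 2 %| red beta.
  rewrite -{2}[red beta]mulr1 expr2 dvdp_mul2l // => /dvdp_leq.
  by rewrite size_poly1 oner_neq0 leqNgt sz_b => /(_ isT).
rewrite -loc_pbE => iso; apply: no_sq.
pose qe (j : 'I_n) := q (delta_mx j 0).
have [q0|[i [a [qi qj]]]] := liso_residue_family h_surj h_ker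
  (@max_ideal_maximal p beta p_prime irr_beta) qe Jbeta iso.
  apply: dvdp_trans (dvd1p _).
  have := @dvdp_det_relations 1%:M; rewrite det1 reduce_mod1; apply=> j.
  by rewrite colE mul1mx; apply: q0.
(* E is the identity matrix with its i-th row replaced by the coefficients that
   express the relations between the q(e_j), and with beta at position (i, i). *)
pose E : 'M[{poly int}]_n := \matrix_(k, j)
  if j == i then beta * (k == i)%:R else (k == j)%:R - a j * (k == i)%:R.
have detE : \det E = beta.
  rewrite (expand_det_col E i) (bigD1 i) //= big1 ?addr0 => [|k /negPf k'i].
    rewrite mxE !eqxx mulr1 /cofactor -signr_odd oddD addbb expr0 mul1r.
    rewrite -[RHS]mulr1 -(det1 _ n.-1); congr (_ * \det _).
    apply/matrixP => k j; rewrite !mxE [fintype.lift i j == i]eq_sym.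
    rewrite (negPf (neq_lift i j)) [fintype.lift i k == i]eq_sym.
    rewrite (negPf (neq_lift i k)) mulr0 subr0.
    by rewrite (inj_eq (@fintype.lift_inj _ i)).
  by rewrite mxE eqxx k'i mulr0 mul0r.
rewrite -[X in _ %| red X]detE; apply: dvdp_det_relations => j.
have q0 : q 0 = 0.
  by rewrite -[0]addr0 -{1}(scaler0 _ (-1)) q_linear scaleN1r addNr.
have [->|j'i] := eqVneq j i.
  have -> : col i E = beta *: delta_mx i 0 + 0.
    by apply/colP=> k; rewrite !mxE !eqxx andbT addr0.
  by rewrite q_linear q0 addr0.
have -> : col j E = - a j *: delta_mx i 0 + delta_mx j 0.
  by apply/colP=> k; rewrite !mxE (negPf j'i) !andbT addrC mulNr.
by rewrite q_linear -/(qe j) qj scaleNr addNr.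
Qed.

End Backward.

Theorem proposition3p8 (n : nat) (M : 'M[int]_n) (p : nat)
    (n_gt0 : (0 < n)%N) (p_prime : prime p) :
  ~~ (p%:Z %| disc (char_poly M))%Z <->
  (forall beta : {poly int},
     beta \is monic -> irreducible_poly (reduce_mod p beta) ->
     liso (modscale p%:R (loc_pb p beta (coker_MxI M))) 'cV[{poly int}]_0 \/
     liso (modscale p%:R (loc_pb p beta (coker_MxI M))) (Fpx_mod p beta)).
Proof.
rewrite dvdz_disc ?char_poly_monic ?size_char_poly // negbK.
split=> [sep_M beta _ irr_beta|iso_beta]; first exact: separable_loc_coker.
apply: contraT => /(nonseparable_square_factor p_prime)[b [mb irr_b sq_b]].
have [beta [red_beta m_beta]] := monic_lift p_prime b.
rewrite -red_beta in irr_b sq_b.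
case: (not_liso_of_square p_prime irr_b sq_b).
exact: iso_beta (m_beta mb) irr_b.
Qed.
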